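(* Let $k:\mathbb{N}\to\mathbb{R}$ satisfy $0\le k(n)\le n$ and $k(n)=n-\omega(\log n)$, i.e. $(n-k(n))/\log n\to\infty$. Then every quantum cryptographic hash function is resilient against $k(n)$ bits of classical leakage. Explicitly: let $(\phi^{(n)})_n$ be any family in which $\phi^{(n)}:x\mapsto|\phi_x\rangle$ assigns to each $x\in\{0,1\}^n$ an $m(n)$-qubit unit vector and $\delta(n)=\max_{x\ne x'}|\langle\phi_x|\phi_{x'}\rangle|$ is negligible in $n$. Then the optimal probability $e_s^*(k(n))$ that a forgery state, obtained from $k(n)$ bits of classical side information about a uniformly random $X\in\{0,1\}^n$, passes the verification scheme for $\phi^{(n)}$ is negligible in $n$.
   Context: A function $\delta(n)$ is negligible in $n$ (written $\mathrm{negl}(n)$) if for every $c>0$, $\delta(n)\le n^{-c}$ for all sufficiently large $n$. Logarithms are base 2. An $(n,m,\delta)$ quantum fingerprinting is a map $\phi:\{0,1\}^n\to\mathbb{C}^{2^m}$, $x\mapsto|\phi_x\rangle$, with unit vectors $|\phi_x\rangle$ and $\delta=\max_{x\neq x'}|\langle\phi_x|\phi_{x'}\rangle|$. Write $\phi_x=|\phi_x\rangle\langle\phi_x|$. A quantum cryptographic hash function is an $(n,m,\delta)$ quantum fingerprinting (understood as a family indexed by $n$) with $\delta=\mathrm{negl}(n)$. Side information: a classical joint distribution $\eta_{XY}=\sum_{x,y}p_{x,y}|x\rangle\langle x|\otimes|y\rangle\langle y|$ with $X$ uniform on $\{0,1\}^n$ and $Y$ on a finite set. Guessing probability: $p_g(X|Y)_\eta=\sum_y\max_x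 p_{x,y}$; conditional min-entropy: $H_{\min}(X|Y)_\eta=-\log p_g(X|Y)_\eta$. The amount of leakage is $n-H_{\min}(X|Y)_\eta$. ''$\ell$ bits of leakage (side information)'' means $n-H_{\min}(X|Y)_\eta\le\ell$. Forgery state: the adversary applies a quantum channel to the $Y$ register only, i.e. for each $y$ prepares an $m$-qubit density operator $\sigma_y$, giving $\rho_{XE}=\sum_{x,y}p_{x,y}|x\rangle\langle x|\otimes\sigma_y$. The verification scheme is the measurement operator $V=\sum_x|x\rangle\langle x|\otimes\phi_x$, and the passing probability is $e_s=\mathrm{Tr}(V\rho_{XE})=\sum_{x,y}p_{x,y}\langle\phi_x|\sigma_y|\phi_x\rangle$. $e_s^*(\ell)$ is the supremum of $e_s$ over all forgery states obtained from $\ell$ bits of side information. $\phi$ is $\sigma$-resilient against $\ell$ bits of classical leakage if $e_s^*(\ell)\le\sigma$; when $\sigma$ is not specified, $\sigma=\mathrm{negl}(n)$. *)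

(* Defs.v *)
From HB Require Import structures.
From mathcomp Require Import all_boot all_order all_algebra.
From mathcomp Require Import spectral.
From mathcomp Require Import all_classical all_reals all_analysis.
From mathcomp Require Import complex mxtens.

Set Implicit Arguments.
Unset Strict Implicit.
Unset Printing Implicit Defensive.

Import Order.TTheory GRing.Theory Num.Theory.
Import numFieldNormedType.Exports.
Local Open Scope classical_set_scope.
Local Open Scope ring_scope.
Local Open Scope complex_scope.
Local Open Scope sesquilinear_scope.

Notation bits n := (n.-tuple bool).

Definition log2 {R : realType} (x : R) : R := ln x / ln 2.

(* At n = 0 the value of n%:R `^ (- c) is a convention, which is harmless since
   only large n matter. *)
Definition negligible {R : realType} (delta : nat -> R) : Prop :=
  forall c : R, 0 < c -> \forall n \near \oo, delta n <= n%:R `^ (- c).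

Section Quantum.
Context {R : realType}.

Definition inner d (u v : 'cV[R[i]]_d) : R[i] := (u ^t* *m v) ord0 ord0.

Definition ketbra d (v : 'cV[R[i]]_d) : 'M[R[i]]_d := v *m v ^t*.

(* The order on R[i] is such that 0 <= z means that z is real and nonnegative. *)
Definition is_density d (A : 'M[R[i]]_d) : Prop :=
  [/\ A \is hermsymmx,
      forall u : 'cV[R[i]]_d, 0 <= inner u (A *m u)
    & \tr A = 1].

Definition basis_ket n (x : bits n) : 'cV[R[i]]_#|{: bits n}| :=
  delta_mx (enum_rank x) ord0.

End Quantum.

Section Fingerprinting.
Context {R : realType}.

(* The norm on R[i] takes its values in R[i]; complex.Re brings them to R. *)
Definition max_overlap n m (phi : bits n -> 'cV[R[i]]_(2 ^ m)) : R :=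
  \big[Num.max/0]_(xx : bits n * bits n | xx.1 != xx.2)
    complex.Re `|inner (phi xx.1) (phi xx.2)|.

Definition is_fingerprinting n m (delta : R)
    (phi : bits n -> 'cV[R[i]]_(2 ^ m)) : Prop :=
  (forall x, inner (phi x) (phi x) = 1) /\ delta = max_overlap phi.

Definition is_quantum_hash (m : nat -> nat)
    (phi : forall n, bits n -> 'cV[R[i]]_(2 ^ m n)) : Prop :=
  exists delta : nat -> R,
    (forall n, is_fingerprinting (delta n) (@phi n)) /\ negligible delta.

End Fingerprinting.

Section SideInformation.
Context {R : realType} {n : nat} {Y : finType}.
Implicit Type p : bits n -> Y -> R.

Definition is_side_information p : Prop :=
  (forall x y, 0 <= p x y) /\ (forall x, \sum_y p x y = (2 ^+ n)^-1).

Definition guessing_prob p : R := \sum_y \big[Num.max/0]_x p x y.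

Definition Hmin p : R := - log2 (guessing_prob p).

Definition leakage p : R := n%:R - Hmin p.

End SideInformation.

Section Forgery.
Context {R : realType} {n m : nat}.
Implicit Type phi : bits n -> 'cV[R[i]]_(2 ^ m).

Definition forgery_state (Y : finType) (p : bits n -> Y -> R)
    (sigma : Y -> 'M[R[i]]_(2 ^ m)) : 'M[R[i]]_(#|{: bits n}| * 2 ^ m) :=
  \sum_x \sum_y (p x y)%:C *: (ketbra (basis_ket x) *t sigma y).

Definition verification phi : 'M[R[i]]_(#|{: bits n}| * 2 ^ m) :=
  \sum_x ketbra (basis_ket x) *t ketbra (phi x).

Definition passing_prob phi (rho : 'M[R[i]]_(#|{: bits n}| * 2 ^ m)) : R :=
  complex.Re (\tr (verification phi *m rho)).

Definition forgery_probs phi (l : R) : set R :=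
  [set e | exists (Y : finType) (p : bits n -> Y -> R)
             (sigma : Y -> 'M[R[i]]_(2 ^ m)),
      [/\ is_side_information p,
          leakage p <= l,
          forall y, is_density (sigma y)
        & e = passing_prob phi (forgery_state p sigma)]].

(* For unit vectors phi x and 0 <= l, this set is nonempty and bounded by 1, so
   that the real-valued sup is the true supremum. *)
Definition opt_passing_prob phi (l : R) : R := sup (forgery_probs phi l).

End Forgery.

Definition is_resilient {R : realType} (m : nat -> nat)
    (phi : forall n, bits n -> 'cV[R[i]]_(2 ^ m n)) (l : nat -> R) : Prop :=
  negligible (fun n => opt_passing_prob (@phi n) (l n)).

(* Main.v *)
Require Import Defs.
From mathcomp Require Import all_boot all_order all_algebra.
From mathcomp Require Import all_classical all_reals all_analysis.
From mathcomp Require Import complex mxtens spectral.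
From mathcomp Require Import ring.
Import Order.TTheory GRing.Theory Num.Theory.
Import numFieldNormedType.Exports.
Local Open Scope classical_set_scope.
Local Open Scope ring_scope.

(* Fix a value y of the side information, write w x = p_{x,y}, s = sigma_y, and
   let B = sum_x w x |phi_x><phi_x|, so that the passing probability given y is
   S = tr(s B) = sum_x w x <phi_x|s|phi_x>.  As s is a state, S^2 <= tr(s B^2),
   and tr(s B^2) is a double sum of the terms
     w x * w x' * <phi_x|phi_x'> * <phi_x'|s|phi_x>.
   Bounding |<phi_x'|s|phi_x>| by (<phi_x|s|phi_x> + <phi_x'|s|phi_x'>) / 2, the
   diagonal contributes at most (max w) * S and the rest at most
   delta * (sum w) * S, so that S <= max w + delta * sum w.  Summing over y, the
   passing probability is at most p_g(X|Y) + delta <= 2^(k(n) - n) + delta(n). *)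

(** * Inner products, positive operators and the bound for one value of the side information *)

Section InnerProduct.
Local Open Scope sesquilinear_scope.
Context {R : realType} {d : nat}.
Implicit Types (u v : 'cV[R[i]]_d) (A B : 'M[R[i]]_d) (a : R[i]).

Lemma innerDr u v w : inner u (v + w) = inner u v + inner u w.
Proof. by rewrite /inner mulmxDr mxE. Qed.

Lemma innerZr a u v : inner u (a *: v) = a * inner u v.
Proof. by rewrite /inner -scalemxAr mxE. Qed.

Lemma inner_conj u v : (inner u v)^* = inner v u.
Proof.
rewrite /inner !mxE rmorph_sum; apply: eq_bigr => i _.
by rewrite rmorphM !mxE /= conjCK mulrC.
Qed.

Lemma innerDl u v w : inner (u + v) w = inner u w + inner v w.
Proof. by rewrite -inner_conj innerDr rmorphD /= !inner_conj. Qed.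

Lemma innerZl a u v : inner (a *: u) v = a^* * inner u v.
Proof. by rewrite -inner_conj innerZr rmorphM /= inner_conj. Qed.

Lemma mxtrace_ketbra A v : \tr (ketbra v *m A) = inner v (A *m v).
Proof. by rewrite -mulmxA mxtrace_mulC trace_mx11 /inner mulmxA. Qed.

Lemma ketbra_mul u v : ketbra u *m ketbra v = inner u v *: (u *m v ^t*).
Proof.
rewrite /ketbra mulmxA -(mulmxA u) [_ ^t* *m v]mx11_scalar mul_mx_scalar.
by rewrite -scalemxAl.
Qed.

Lemma inner_hermitian A u v :
  A \is hermsymmx -> (inner u (A *m v))^* = inner v (A *m u).
Proof.
move=> /is_hermitianmxP; rewrite expr0 scale1r => AE.
rewrite inner_conj /inner trmx_mul map_mxM /= -mulmxA; congr ((_ *m _) _ _).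
by rewrite -AE.
Qed.

(** A Cauchy-Schwarz bound in arithmetic-mean form: it is the nonnegativity of the form of [A] at
    [u + t *: v], for a phase [t] that turns both cross terms into [- |z|]. *)
Lemma norm_inner_psd_le A u v :
    A \is hermsymmx -> (forall u, 0 <= inner u (A *m u)) ->
  `|inner u (A *m v)| <= (inner u (A *m u) + inner v (A *m v)) / 2.
Proof.
move=> Ah A0; set z := inner u _.
have [->|z0] := eqVneq z 0; first by rewrite normr0 divr_ge0 ?addr_ge0.
have n0 : `|z| != 0 by rewrite normr_eq0.
(* the phase that makes the cross term equal to [- 2 * `|z|] *)
pose t := - (z^* / `|z|).
have tE : t * t^* = 1.
  rewrite /t rmorphN rmorphM /= conjCK fmorphV /= conj_normC mulrNN mulrACA.
  rewrite [z^* * z]mulrC -normCK -invfM -expr2 divff //.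
  by rewrite expf_neq0.
have tz : t * z = - `|z|.
  by rewrite /t mulNr mulrAC [z^* * z]mulrC -normCK expr2 mulfK.
have tz' : t^* * z^* = - `|z| by rewrite -rmorphM /= tz rmorphN /= conj_normC.
have := A0 (u + t *: v).
rewrite mulmxDr -scalemxAr innerDl !innerDr innerZl innerZr !innerZl innerZr.
rewrite -(inner_hermitian _ u v) // -/z tz tz' mulrCA mulrA tE mul1r.
rewrite ler_pdivlMr ?ltr0n // => h.
by rewrite -subr_ge0; congr (_ <= _): h; ring.
Qed.

(** By cyclicity the trace is that of [B ^t* *m A *m B], whose diagonal entries are the values of
    the form of [A] at the columns of [B]. *)
Lemma mxtrace_psd_sqr_ge0 A B :
    (forall u, 0 <= inner u (A *m u)) -> B ^t* = B ->
  0 <= \tr (A *m (B *m B)).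
Proof.
move=> A0 BE; rewrite mulmxA mxtrace_mulC -{1}BE.
apply: sumr_ge0 => i _; have := A0 (col i B).
rewrite /inner !mxE; congr (_ <= _); apply: eq_bigr => j _.
rewrite !mxE; congr (_ * _); apply: eq_bigr => l _.
by rewrite !mxE.
Qed.

(* Nonnegativity of the variance of the observable [B] in the state [A]. *)
Lemma sqr_mxtrace_density_le A B :
    is_density A -> B ^t* = B -> \tr (A *m B) \is Num.real ->
  \tr (A *m B) ^+ 2 <= \tr (A *m (B *m B)).
Proof.
move=> [_ A0 A1] BE; set S := \tr _ => SR.
have /(mxtrace_psd_sqr_ge0 _ _ A0) : (B - S%:M) ^t* = B - S%:M.
  rewrite linearB /= tr_scalar_mx map_mxB BE map_scalar_mx /=.
  by rewrite (CrealP SR).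
have -> : (B - S%:M) *m (B - S%:M) = B *m B - S *: B - (S *: B - (S * S)%:M).
  rewrite mulmxBl !mulmxBr !(mul_scalar_mx, mul_mx_scalar).
  by rewrite scale_scalar_mx.
rewrite !mulmxBr mul_mx_scalar -!scalemxAr !raddfB /= !mxtraceZ A1 mulr1.
by rewrite opprK addNr addr0 subr_ge0 expr2.
Qed.

Lemma ketbra_hermitian (v : 'cV[R[i]]_d) : (ketbra v) ^t* = ketbra v.
Proof. by rewrite /ketbra trmx_mul map_mxM /= trmxCK. Qed.

(** Stated over [R[i]], where [0 <= w x] also says that the weight is real, so that [B] below is
    Hermitian. The weights need not sum to 1: they will be [p x y] for a fixed [y]. *)
Lemma sum_density_le (I : finType) (w : I -> R[i]) (phi : I -> 'cV[R[i]]_d) A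
    (M delta : R[i]) :
    is_density A -> (forall x, inner (phi x) (phi x) = 1) ->
    0 <= M -> 0 <= delta -> (forall x, 0 <= w x <= M) ->
    (forall x y, x != y -> `|inner (phi x) (phi y)| <= delta) ->
  \sum_x w x * inner (phi x) (A *m phi x) <= M + delta * \sum_x w x.
Proof.
move=> Ad phi1 M0 delta0 wM phi_delta; have [Ah A0 A1] := Ad.
have w0 x : 0 <= w x by case/andP: (wM x).
have wle x : w x <= M by case/andP: (wM x).
pose s x := inner (phi x) (A *m phi x); have s0 x : 0 <= s x by exact: A0.
pose B := \sum_x w x *: ketbra (phi x).
pose S := \sum_x w x * s x; rewrite -/S.
have S0 : 0 <= S by apply: sumr_ge0 => x _; rewrite mulr_ge0.
have SE : \tr (A *m B) = S.
  rewrite mulmx_sumr raddf_sum; apply: eq_bigr => x _ /=.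
  by rewrite -scalemxAr mxtraceZ mxtrace_mulC mxtrace_ketbra.
have BE : B ^t* = B.
  rewrite /B raddf_sum /= map_mx_sum; apply: eq_bigr => x _.
  rewrite linearZ /= map_mxZ /= (CrealP (ger0_real (w0 x))).
  by rewrite ketbra_hermitian.
have BBE : \tr (A *m (B *m B)) = \sum_x \sum_y
    w x * w y * (inner (phi x) (phi y) * inner (phi y) (A *m phi x)).
  rewrite mulmx_suml mulmx_sumr raddf_sum; apply: eq_bigr => x _ /=.
  rewrite -scalemxAl -scalemxAr mxtraceZ !mulmx_sumr raddf_sum mulr_sumr.
  apply: eq_bigr => y _ /=.
  rewrite -!scalemxAr mxtraceZ ketbra_mul -scalemxAr mxtraceZ -mulrA.
  congr (_ * (_ * (_ * _))).
  by rewrite mulmxA mxtrace_mulC trace_mx11.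
(* Keeping [delta] on the diagonal too is wasteful but lets the [delta] part run over all pairs,
   where the double sum factors as [delta * (\sum_x w x) * S]. *)
pose g (x y : I) : R[i] := (x == y)%:R + delta.
have g_le x y : `|inner (phi x) (phi y)| <= g x y.
  rewrite /g; have [<-|xy] := eqVneq x y; last by rewrite add0r phi_delta.
  by rewrite phi1 normr1 lerDl.
have BB_le : \tr (A *m (B *m B)) <=
    \sum_x \sum_y w x * w y * (g x y * ((s x + s y) / 2)).
  rewrite -(ger0_norm (mxtrace_psd_sqr_ge0 _ _ A0 BE)) BBE.
  apply: le_trans (ler_norm_sum _ _ _) _; apply: ler_sum => x _.
  apply: le_trans (ler_norm_sum _ _ _) _; apply: ler_sum => y _.
  rewrite normrM [`|w x * _|]ger0_norm ?mulr_ge0 //.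
  rewrite ler_wpM2l ?mulr_ge0 // normrM.
  by rewrite ler_pM // [s x + _]addrC norm_inner_psd_le.
have gE : \sum_x \sum_y w x * w y * (g x y * ((s x + s y) / 2)) =
    \sum_x w x * (w x * s x) + delta * (\sum_x w x) * S.
  transitivity (\sum_x (w x * (w x * s x) +
      delta / 2 * (w x * s x * (\sum_y w y) + w x * S))).
    apply: eq_bigr => x _.
    rewrite (eq_bigr (fun y => (x == y)%:R * (w x * w y * ((s x + s y) / 2)) +
      delta / 2 * (w x * s x * w y + w x * (w y * s y)))); last first.
      by move=> y _; rewrite /g; field.
    rewrite big_split /= -mulr_sumr big_split /= -!mulr_sumr; congr (_ + _).
    rewrite (bigD1 x) //= eqxx mul1r big1 ?addr0; last first.
      by move=> y; rewrite eq_sym => /negPf ->; rewrite mul0r.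
    by field.
  rewrite big_split /= -mulr_sumr big_split /= -!mulr_suml -/S; congr (_ + _).
  by field.
(* In the diagonal part, one of the two factors [w x] is bounded by [M]; the other rebuilds [S]. *)
have SS_le : S * S <= (M + delta * \sum_x w x) * S.
  rewrite -expr2 -{1}SE; apply: le_trans (sqr_mxtrace_density_le _ _ Ad BE _) _.
    by rewrite SE ger0_real.
  apply: le_trans BB_le _; rewrite gE mulrDl lerD2r /S mulr_sumr.
  by apply: ler_sum => x _; rewrite ler_wpM2r // mulr_ge0.
have [S_eq0|S_neq0] := eqVneq S 0.
  by rewrite S_eq0 addr_ge0 // mulr_ge0 // sumr_ge0.
by rewrite -(ler_pM2r (_ : 0 < S)) // lt_def S_neq0.
Qed.

End InnerProduct.

(** * Passing probabilities of forgery states *)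

Lemma mxtrace_tens (C : comPzRingType) m n (A : 'M[C]_m) (B : 'M[C]_n) :
  \tr (A *t B) = \tr A * \tr B.
Proof.
rewrite /mxtrace mulr_sum; apply: eq_bigr => k _.
by case: (mxtens_indexP k) => i j; rewrite tensmxE mxtens_indexK.
Qed.

Lemma mxtrace_ketbra_basis {R : realType} n (x y : bits n) :
  \tr (ketbra (basis_ket x) *m ketbra (basis_ket y)) = (x == y)%:R :> R[i].
Proof.
rewrite ketbra_mul mxtraceZ mxtrace_mulC trace_mx11 -!/(inner _ _).
have innerE (a b : bits n) :
    inner (basis_ket a) (basis_ket b) = (a == b)%:R :> R[i].
  rewrite /inner !mxE (bigD1 (enum_rank a)) //= big1 => [|i ia].
    by rewrite !mxE !eqxx /= conjC1 mul1r addr0 (inj_eq enum_rank_inj) andbT.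
  by rewrite !mxE (negPf ia) /= conjC0 mul0r.
by rewrite !innerE eq_sym -natrM mulnb andbb.
Qed.

(** The basis kets are orthonormal, so only the matching terms of the verification operator and the
    forgery state survive in the trace. *)
Lemma passing_prob_forgery {R : realType} n m (Y : finType)
    (p : bits n -> Y -> R) (sigma : Y -> 'M[R[i]]_(2 ^ m))
    (phi : bits n -> 'cV[R[i]]_(2 ^ m)) :
  passing_prob phi (forgery_state p sigma) =
  complex.Re (\sum_y \sum_x (p x y)%:C%C * inner (phi x) (sigma y *m phi x)).
Proof.
congr complex.Re; rewrite exchange_big /= mulmx_suml raddf_sum.
apply: eq_bigr => x _ /=; rewrite mulmx_sumr raddf_sum (bigD1 x) //=.
rewrite [X in _ + X]big1 => [|x' x'x].
  rewrite addr0 mulmx_sumr raddf_sum; apply: eq_bigr => y _ /=.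
  rewrite -scalemxAr mxtraceZ tensmx_mul mxtrace_tens mxtrace_ketbra_basis.
  by rewrite eqxx mul1r mxtrace_ketbra.
rewrite mulmx_sumr raddf_sum big1 // => y _ /=.
rewrite -scalemxAr mxtraceZ tensmx_mul mxtrace_tens mxtrace_ketbra_basis.
by rewrite eq_sym (negPf x'x) mul0r mulr0.
Qed.

Lemma guessing_prob_le {R : realType} n (Y : finType) (p : bits n -> Y -> R) l :
  leakage p <= l -> guessing_prob p <= 2 `^ (l - n%:R).
Proof.
rewrite /leakage /Hmin opprK /log2 => leak_le.
(* [ln] is 0 at nonpositive arguments, where [leak_le] carries no information *)
have [pg_le0|pg_gt0] := leP (guessing_prob p) 0.
  exact: le_trans pg_le0 (powR_ge0 _ _).
have ln2_gt0 : 0 < ln 2 :> R by rewrite ln_gt0 // ltr1n.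
rewrite -[leLHS]lnK ?posrE // /powR pnatr_eq0 /= ler_expR -ler_pdivrMr //.
by rewrite lerBrDl.
Qed.

Lemma opt_passing_prob_le {R : realType} n m
    (phi : bits n -> 'cV[R[i]]_(2 ^ m)) (l : R) :
    (forall x, inner (phi x) (phi x) = 1) ->
  opt_passing_prob phi l <= 2 `^ (l - n%:R) + max_overlap phi.
Proof.
move=> phi1; set B := leRHS.
have overlap_ge0 : 0 <= max_overlap phi by exact: bigmax_ge_id.
have B_ge0 : 0 <= B by rewrite addr_ge0 ?powR_ge0.
(* As [l] may be negative, the set may be empty; its [sup] is then 0 by convention. *)
have [E0|/set0P E_neq0] := eqVneq (forgery_probs phi l) set0.
  by rewrite /opt_passing_prob E0 sup0.
apply: ge_sup => // _ [Y [p [sigma [[p0 p_unif] leak_le sigma_density ->]]]].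
rewrite passing_prob_forgery.
have p_sum : \sum_y \sum_x p x y = 1.
  rewrite exchange_big /= (eq_bigr (fun=> (2 ^+ n)^-1)) //.
  rewrite sumr_const card_tuple card_bool -[_ *+ _]mulr_natr natrX.
  by rewrite mulVf ?expf_neq0 ?pnatr_eq0.
apply: (@le_trans _ _ (guessing_prob p + max_overlap phi * \sum_y \sum_x p x y)).
  (* An inequality in [R[i]] implies the one between real parts, and it can be proved for each [y]
     separately. *)
  suff : \sum_y \sum_x (p x y)%:C%C * inner (phi x) (sigma y *m phi x) <=
      (guessing_prob p + max_overlap phi * \sum_y \sum_x p x y)%:C%C.
    by rewrite lecE => /andP[].
  rewrite rmorphD rmorphM /= !rmorph_sum /= mulr_sumr -big_split /=.
  apply: ler_sum => y _; rewrite rmorph_sum /=.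
  apply: sum_density_le => //.
  - by rewrite ler0c bigmax_ge_id.
  - by rewrite ler0c.
  - by move=> x; rewrite ler0c p0 lecR /= (le_bigmax 0 (fun x => p x y) x).
  move=> x x' xx'; rewrite -[leLHS]RRe_real ?normr_real // lecR.
  exact: (le_bigmax_cond 0 (fun xx : bits n * bits n =>
    complex.Re `|inner (phi xx.1) (phi xx.2)|) (j := (x, x'))).
by rewrite p_sum mulr1 lerD2r guessing_prob_le.
Qed.

(** * Negligible functions and the conclusion *)

Lemma negligibleD {R : realType} (f g : nat -> R) :
  Defs.negligible f -> Defs.negligible g ->
  Defs.negligible (fun n => f n + g n).
Proof.
move=> f_negl g_negl c c0; have c1 : 0 < c + 1 by rewrite addr_gt0.
near=> n.
have n2 : (2 <= n)%N by near: n; exact: nbhs_infty_ge.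
have n0 : (n%:R : R) != 0 by rewrite pnatr_eq0 -lt0n ltnW.
(* The extra 1 in the exponent absorbs the factor 2, since [2 / n <= 1] for [n >= 2]. *)
apply: (@le_trans _ _ (n%:R `^ (- (c + 1)) + n%:R `^ (- (c + 1)))).
  by apply: lerD; near: n; [exact: f_negl|exact: g_negl].
rewrite opprD powRD ?n0 ?implybT // powR_inv1 ?ler0n // -mulrDr.
rewrite ler_piMr ?powR_ge0 // -mulr2n -[leLHS]mulr_natl.
by rewrite ler_pdivrMr ?mul1r ?ler_nat // ltr0n ltnW.
Unshelve. all: by end_near. Qed.

(** Once [a n >= c * log2 n], the power of 2 is at most [2 ^ (- c * log2 n)], which is
    [n ^ (- c)]. *)
Lemma negligible_exp2 {R : realType} (a : nat -> R) :
    (a n / log2 n%:R @[n --> \oo] --> +oo) ->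
  Defs.negligible (fun n => 2 `^ (- a n)).
Proof.
move=> a_omega c c0; near=> n.
have n2 : (2 <= n)%N by near: n; exact: nbhs_infty_ge.
have ln2_gt0 : 0 < ln 2 :> R by rewrite ln_gt0 // ltr1n.
have lnn_gt0 : 0 < ln n%:R :> R by rewrite ln_gt0 // ltr1n.
have : c <= a n / log2 n%:R by near: n; exact: cvgry_ge.
rewrite /log2 ler_pdivlMr ?divr_gt0 // mulrA ler_pdivrMr // => ac.
rewrite /powR !pnatr_eq0 [n == 0%N]eqn0Ngt (ltnW n2) /=.
by rewrite ler_expR !mulNr lerN2.
Unshelve. all: by end_near. Qed.

Theorem theorem1p1 (R : realType) (k : nat -> R)
    (k_bounds : forall n, 0 <= k n <= n%:R)
    (k_omega : (n%:R - k n) / log2 n%:R @[n --> \oo] --> +oo)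
    (m : nat -> nat) (phi : forall n : nat, n.-tuple bool -> 'cV[R[i]]_(2 ^ m n))
    (phi_hash : is_quantum_hash phi) :
  is_resilient phi k.
Proof.
case: phi_hash => delta [phi_fp delta_negl] c c0.
have := negligibleD _ _ (negligible_exp2 _ k_omega) delta_negl c c0.
apply: filterS => n; apply: le_trans; have [phi1 ->] := phi_fp n.
by rewrite opprB; exact: opt_passing_prob_le.
Qed.
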